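(* Let $k \ge 4$ be a fixed integer and let $(x,t)$ be a given pair of positive integers. The sequence $n \mapsto F_{x,t}^{(k)}(n)$, defined for $n \in \mathcal{D}_{x,t}^{(k)}$, satisfies: \begin{enumerate} \item It is strictly decreasing. \item It is bounded below by $0$. \item By the monotone convergence theorem applied to the finite sequence $(F_{x,t}^{(k)}(n))_{n \in \mathcal{D}_{x,t}^{(k)}}$, it attains its infimum at the last element of the domain. Denote \[ L_{x,t} = \min_{n \in \mathcal{D}_{x,t}^{(k)}} F_{x,t}^{(k)}(n) \ge 0. \] In particular, $L_{x,t} = F_{x,t}^{(k)}(N_{x,t})$, where $N_{x,t} = \max \mathcal{D}_{x,t}^{(k)}$. \item For every $n \in \mathcal{D}_{x,t}^{(k)}$, we have the inequality \[ 0 \le L_{x,t} \le F_{x,t}^{(k)}(n) \le F_{x,t}^{(k)}(m_{x,t}), \] where $m_{x,t} = \min \mathcal{D}_{x,t}^{(k)}$ (the smallest admissible value). \item In particular, $F_{x,t}^{(k)}$ is bounded on $\mathcal{D}_{x,t}^{(k)}$, and we may take \[ C(x,t) = F_{x,t}^{(k)}(m_{x,t}) \] as an explicit upper bound (independent of $n$ within this domain). \end{enumerate}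
   Context: Let $N_1 \ge 2$ be an integer (a threshold, which may depend on $k$). For a fixed integer $k \ge 4$ and positive integers $x,t$, define \[ F_{x,t}^{(k)}(n) = t^2(kx-n)^2 - 2nxt, \] and define the admissible domain of the pair $(x,t)$ by \[ \mathcal{D}_{x,t}^{(k)} = \left\{ n \in \mathbb{N},\ n \ge N_1 \ge 2 \ \middle|\ n < kx \ \text{and}\ t \ge \frac{2nx}{(kx-n)^2} \right\}. \] *)

(* Defs.v *)
From HB Require Import structures.
From mathcomp Require Import all_boot all_order all_algebra.
From mathcomp Require Import all_classical all_reals all_analysis.

Set Implicit Arguments.
Unset Strict Implicit.
Unset Printing Implicit Defensive.

Import Order.TTheory GRing.Theory Num.Theory.
Import numFieldNormedType.Exports.

Local Open Scope classical_set_scope.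
Local Open Scope ring_scope.

(* All arithmetic takes place in R after embedding the natural numbers, so the
   difference k * x - n is not truncated. *)
Definition F (R : realType) (k x t n : nat) : R :=
  t%:R ^+ 2 * (k%:R * x%:R - n%:R) ^+ 2 - 2 * n%:R * x%:R * t%:R.

Definition admissible (R : realType) (k N1 x t : nat) : set nat :=
  [set n | [/\ (N1 <= n)%N, (n < k * x)%N &
     (2 * n%:R * x%:R / (k%:R * x%:R - n%:R) ^+ 2 : R) <= t%:R]].

Definition is_min (d : Order.disp_t) (T : porderType d) (A : set T) (a : T) :=
  A a /\ lbound A a.

Definition is_max (d : Order.disp_t) (T : porderType d) (A : set T) (a : T) :=
  A a /\ ubound A a.

(* Main.v *)
(** With a = kx - n > 0, both terms of t^2 a^2 - 2nxt decrease strictly in n as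
    long as n <= kx, and admissibility, multiplied by t a^2, says exactly that
    the value is nonnegative.  The domain lies below kx, hence is finite, and
    its extremal elements carry the extremal values in the opposite order. *)

Require Import Defs.
From HB Require Import structures.
From mathcomp Require Import all_boot all_order all_algebra.
From mathcomp Require Import all_classical all_reals all_analysis.
From mathcomp Require Import lra.

Import Order.TTheory GRing.Theory Num.Theory.
Import numFieldNormedType.Exports.

Local Open Scope classical_set_scope.
Local Open Scope ring_scope.

Lemma is_min_nat_exists (A : set nat) : A !=set0 -> exists m, is_min A m.
Proof.
(* [ex_minnP] searches along a boolean predicate, so [A] is passed through its classical
   reflection. *)
move=> [n An]; have exA : exists n, `[< A n >] by exists n; apply/asboolP.
case: (ex_minnP exA) => m /asboolP Am mP; exists m; split=> // p Ap.
by rewrite leEnat; apply/mP/asboolP.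
Qed.

Lemma is_max_nat_exists (A : set nat) (b : nat) :
  A !=set0 -> (forall n, A n -> (n <= b)%N) -> exists M, is_max A M.
Proof.
move=> [n An] Ab; have exA : exists n, `[< A n >] by exists n; apply/asboolP.
have leb p : `[< A p >] -> (p <= b)%N by move=> /asboolP /Ab.
case: (ex_maxnP exA leb) => M /asboolP AM MP; exists M; split=> // p Ap.
by rewrite leEnat; apply/MP/asboolP.
Qed.

Lemma inf_is_min (R : realType) (A : set R) (a : R) : is_min A a -> inf A = a.
Proof.
move=> [Aa lba]; apply/le_anti/andP; split.
  (* [a] discharges both side conditions on [inf]: here as a lower bound, then as an element showing
     [A] nonempty. *)
  by apply: ge_inf => //; exists a.
by apply: lb_le_inf => //; exists a.
Qed.

Lemma F_decreasing (R : realType) (k x t n n' : nat) :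
  (0 < x)%N -> (0 < t)%N -> (n < n')%N -> (n' <= k * x)%N ->
  F R k x t n' < F R k x t n.
Proof.
move=> x0 t0 nn' n'kx; rewrite /F.
have hx : 0 < x%:R :> R by rewrite ltr0n.
have ht : 0 < t%:R :> R by rewrite ltr0n.
have hn : n%:R < n'%:R :> R by rewrite ltr_nat.
have hn' : n'%:R <= k%:R * x%:R :> R by rewrite -natrM ler_nat.
(* The linear term alone supplies strictness. The squares are compared weakly, both differences
   being nonnegative by [hn']. *)
apply: ler_ltB.
  by rewrite ler_pM2l ?exprn_gt0// ler_sqr ?nnegrE; lra.
by rewrite !ltr_pM2r// ltr_pM2l.
Qed.

Lemma F_nonincreasing (R : realType) (k x t n n' : nat) :
  (0 < x)%N -> (0 < t)%N -> (n <= n')%N -> (n' <= k * x)%N ->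
  F R k x t n' <= F R k x t n.
Proof.
move=> x0 t0; rewrite leq_eqVlt => /predU1P[-> //|nn' n'kx].
exact/ltW/F_decreasing.
Qed.

Lemma F_admissible_ge0 (R : realType) (k N1 x t n : nat) :
  admissible R k N1 x t n -> 0 <= F R k x t n.
Proof.
move=> [_ nkx]; have a0 : 0 < k%:R * x%:R - n%:R :> R.
  by rewrite subr_gt0 -natrM ltr_nat.
rewrite ler_pdivrMr ?exprn_gt0// => le_t.
(* One further factor [t] turns [2nx <= t a^2] into [2nxt <= t^2 a^2], where [a = kx - n]. *)
by rewrite /F subr_ge0 [leRHS]mulrC expr2 mulrA ler_wpM2r// mulrC.
Qed.

Theorem proposition2 (R : realType) (k N1 x t : nat)
    (hk : (4 <= k)%N) (hN1 : (2 <= N1)%N) (hx : (0 < x)%N) (ht : (0 < t)%N) :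
  let D := admissible R k N1 x t in
  let f : nat -> R := F R k x t in
  [/\ (* 1 *) forall n n' : nat, D n -> D n' -> (n < n')%N -> f n' < f n,
      (* 2 *) forall n : nat, D n -> 0 <= f n,
      (* 3, finiteness *) finite_set D,
      (* 5, boundedness *) [bounded f n | n in D]
    & D !=set0 ->
      exists (m N : nat) (L : R),
        [/\ is_min D m, is_max D N, is_min (f @` D) L
          & [/\ (* 3 *) [/\ f N = inf (f @` D), L = f N & 0 <= L],
                (* 4 *) forall n : nat, D n ->
                          [/\ 0 <= L, L <= f n & f n <= f m]
              & (* 5 *) ubound (f @` D) (f m)]]].
Proof.
move=> D f.
have Dlt n : D n -> (n < k * x)%N by case.
have Dle n : D n -> (n <= k * x)%N by move=> /Dlt /ltnW.
have f_ge0 n : D n -> 0 <= f n by exact: F_admissible_ge0.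
have f_ni n n' : D n' -> (n <= n')%N -> f n' <= f n.
  by move=> Dn' nn'; apply: F_nonincreasing => //; exact: Dle.
split=> //.
- by move=> n n' _ Dn' nn'; apply: F_decreasing => //; exact: Dle.
- by apply: (sub_finite_set _ (finite_II (k * x))) => n /Dlt.
(* [D] may be empty here, so its minimum cannot serve. The index [0] lies outside [D], but [f_ni]
   asks membership only of the larger index. Boundedness quantifies over every [M] above the chosen
   real. *)
- exists (f 0%N); split; first exact: num_real.
  move=> M /ltW f0M n Dn /=; rewrite ger0_norm ?f_ge0//.
  exact: le_trans (f_ni _ _ Dn (leq0n n)) f0M.
move=> D0.
have [m [Dm lem]] := is_min_nat_exists _ D0.
have [N [DN geN]] := is_max_nat_exists _ _ D0 Dle.
have fN_min : is_min (f @` D) (f N).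
  by split; [exists N | move=> _ [n Dn <-]; exact: f_ni DN (geN _ Dn)].
have fm_max n : D n -> f n <= f m by move=> Dn; exact: f_ni Dn (lem _ Dn).
exists m, N, (f N); split=> //; split.
- by rewrite (inf_is_min _ _ _ fN_min); split=> //; exact: f_ge0.
- by move=> n Dn; split; [exact: f_ge0 | exact: f_ni DN (geN _ Dn) | exact: fm_max].
- by move=> _ [n Dn <-]; exact: fm_max.
Qed.
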